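(* Let $\ast$ be a revision operation defined by the counting variant $d_c$ or by the set variant $d_s$ of the Hamming distance on the models of a classical propositional language $\mathcal{L}$, i.e. $M(T\ast\phi) = M(T)\mid M(\phi)$ for all theories $T$ and formulas $\phi$ of $\mathcal{L}$, where $\mid$ is formed with respect to $d_c$ or $d_s$, respectively. Then $\ast$ factorizes: whenever $T$ is a theory, $\phi$ a formula, and the set of propositional variables of $\mathcal{L}$ is partitioned into the variable sets of sublanguages $\mathcal{L}_1,\dots,\mathcal{L}_n$ such that $$M(T) = M(T)\lceil\mathcal{L}_1\times\dots\times M(T)\lceil\mathcal{L}_n,\qquad M(\phi) = M(\phi)\lceil\mathcal{L}_1\times\dots\times M(\phi)\lceil\mathcal{L}_n,$$ then $$M(T)\mid M(\phi) = \big((M(T)\lceil\mathcal{L}_1)\mid(M(\phi)\lceil\mathcal{L}_1)\big)\times\dots\times\big((M(T)\lceil\mathcal{L}_n)\mid(M(\phi)\lceil\mathcal{L}_n)\big).$$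
   Context: A model of $\mathcal{L}$ is a function from the set of propositional variables $v(\mathcal{L})$ to $\{0,1\}$; $M(T)$ and $M(\phi)$ denote the sets of models of the theory $T$ and the formula $\phi$. For a set $\mathcal{X}$ of models and a sublanguage $\mathcal{L}_i$, $\mathcal{X}\lceil\mathcal{L}_i$ is the set of restrictions of elements of $\mathcal{X}$ to $v(\mathcal{L}_i)$. A product of sets of functions on the disjoint variable sets $v(\mathcal{L}_1),\dots,v(\mathcal{L}_n)$ is identified with the set of all unions $\sigma_1\cup\dots\cup\sigma_n$ with $\sigma_i$ in the $i$-th factor. Hamming distances: for functions $x,y$ on the same index set $I$, the set variant is $d_s(x,y) := \{i\in I : x(i)\neq y(i)\}$, with distances compared by inclusion ($d_s(x,y)\le d_s(x',y')$ iff $d_s(x,y)\subseteq d_s(x',y')$, so distances are not always comparable); the counting variant is $d_c(x,y) := \mathrm{card}(d_s(x,y))$, with distances compared as cardinals. For sets $\Sigma, \Theta$ of functions on the same index set and a distance $d\in\{d_s,d_c\}$, $\Sigma\mid\Theta$ is the set of elements of $\Theta$ with minimal distance from $\Sigma$: $\Sigma\mid\Theta := \{\tau\in\Theta : \text{there is } \sigma\in\Sigma \text{ such that there are no } \sigma'\in\Sigma,\ \tau'\in\Theta \text{ with } d(\sigma',\tau') < d(\sigma,\tau)\}$, where $<$ is the strict part of the order on distances. On the components, $d$ is the Hamming distance of the same variant over the index set $v(\mathcal{L}_i)$. *)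

(* Defs.v *)
From mathcomp Require Import all_boot.
From mathcomp Require Import boolp classical_sets functions cardinality.

Set Implicit Arguments.
Unset Strict Implicit.
Unset Printing Implicit Defensive.

Local Open Scope classical_set_scope.
Local Open Scope card_scope.

(* The language is given by its type V of propositional variables, which may be
   infinite and of any cardinality; a sublanguage is given by its set of
   variables. *)

Inductive propform (V : Type) : Type :=
  | PVar of V
  | PBot
  | PNot of propform V
  | PAnd of propform V & propform V
  | POr of propform V & propform V
  | PImp of propform V & propform V.

Definition theory (V : Type) : Type := set (propform V).

Definition model (V : Type) : Type := V -> bool.

Fixpoint sat (V : Type) (m : model V) (phi : propform V) : bool :=
  match phi with
  | PVar p => m p
  | PBot => false
  | PNot a => ~~ sat m a
  | PAnd a b => sat m a && sat m b
  | POr a b => sat m a || sat m b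
  | PImp a b => sat m a ==> sat m b
  end.

Definition form_models (V : Type) (phi : propform V) : set (model V) :=
  [set m | sat m phi].

Definition theory_models (V : Type) (T : theory V) : set (model V) :=
  [set m | forall phi, T phi -> sat m phi].

Definition restr (V : Type) (X : set (model V)) (A : set V) : set (model A) :=
  sigL A @` X.

Arguments restr {V} X A _.

(* The graph of f is the union of the graphs of the s i. *)
Definition is_union (V I : Type) (L : I -> set V) (s : forall i, model (L i))
    (f : model V) : Prop :=
  forall x b, f x = b <-> exists i (y : L i), set_val y = x /\ s i y = b.

Definition model_prod (V I : Type) (L : I -> set V)
    (Y : forall i, set (model (L i))) : set (model V) :=
  [set f | exists2 s : forall i, model (L i),
             forall i, Y i (s i) & is_union s f].

Definition partitions (V I : Type) (L : I -> set V) : Prop :=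
  trivIset [set: I] L /\ \bigcup_i L i = [set: V].

Inductive hamming_variant : Type := SetVariant | CountingVariant.

Definition hamming (I : Type) (x y : model I) : set I := [set i | x i <> y i].

(* In both variants a distance is represented by the set of indices where the
   two functions differ; the counting variant compares these sets by their
   (possibly infinite) cardinals. *)
Definition dist_le (d : hamming_variant) (I : Type) (A B : set I) : Prop :=
  match d with
  | SetVariant => A `<=` B
  | CountingVariant => A #<= B
  end.

Definition dist_lt (d : hamming_variant) (I : Type) (A B : set I) : Prop :=
  dist_le d A B /\ ~ dist_le d B A.

(* Sigma | Theta *)
Definition closest (d : hamming_variant) (I : Type)
    (Sigma Theta : set (model I)) : set (model I) :=
  [set tau | Theta tau /\
     exists2 sigma, Sigma sigma &
       ~ exists sigma' tau', [/\ Sigma sigma', Theta tau' &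
           dist_lt d (hamming sigma' tau') (hamming sigma tau)]].

Definition defined_by (d : hamming_variant) (V : Type)
    (star : theory V -> propform V -> theory V) : Prop :=
  forall T phi, theory_models (star T phi) =
                closest d (theory_models T) (form_models phi).

(* Main.v *)
Require Import Defs.
From mathcomp Require Import all_boot.
From mathcomp Require Import boolp classical_sets functions cardinality.
From mathcomp Require Import finmap.

(** Write [H] for the set of variables on which two models differ. Under the
    factorization hypotheses, models of [T] (and of [phi]) can be chosen
    independently on the blocks [L i], so the traces of [H] on the blocks can be
    varied independently. It remains to compare distances blockwise.

    - Blockwise minimal implies minimal: if the trace of [H] on each block is
      at most that of [H'], then [H] is at most [H'] ([dist_le_glue]; for the
      counting variant the injections between the traces are glued).
    - Minimal implies blockwise minimal: a pair that improves one block can be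
      spliced into the given pair, and this is a strict global improvement
      ([dist_lt_splice]).

    For the counting variant the second step fails for infinite cardinals, whose
    sums absorb strict improvements, and the first step uses that cardinals are
    comparable. Finiteness settles both: [phi] mentions only finitely
    many variables, so any model of [T] differs from some model of [phi] on a
    finite set only ([finite_gap]), and hence all minimal distances, global or
    blockwise, are finite ([minimal_dist_finite]). *)

Set Implicit Arguments.
Unset Strict Implicit.
Unset Printing Implicit Defensive.

Local Open Scope classical_set_scope.
Local Open Scope card_scope.

(** * Disjoint unions and their cardinals *)

Lemma finite_card_le_total (T U : Type) (A : set T) (B : set U) :
  finite_set A -> A #<= B \/ B #<= A.
Proof.
move=> finA; have [finB|infB] := pselect (finite_set B); last first.
  left; apply: card_le_trans (iffLR (infiniteP B) infB).
  exact: finite_set_countable.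
have [a Aa] := finA; have [b Bb] := finB.
rewrite (card_le_eql Aa) (card_le_eqr Bb) (card_le_eql Bb) (card_le_eqr Aa).
by rewrite !card_le_II; apply/orP; exact: leq_total.
Qed.

Lemma card_eq_disjU (T : Type) (A B : set T) (a b : nat) :
  A #= `I_a -> B #= `I_b -> A `&` B = set0 -> A `|` B #= `I_(a + b).
Proof.
elim/Pchoice: T => T in A B *.
move=> Aa Bb AB0.
have finA : finite_set A by exists a.
have finB : finite_set B by exists b.
have finU : finite_set (A `|` B) by rewrite finite_setU.
rewrite -(fset_setK finA) in Aa; rewrite -(fset_setK finB) in Bb.
rewrite -(fset_setK finU); apply/card_eq_fsetP.
rewrite fset_setU// cardfsU -fset_setI// AB0 fset_set0 cardfs0 subn0.
by move/card_eq_fsetP: Aa => ->; move/card_eq_fsetP: Bb => ->.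
Qed.

(** Cancellation of a common part; it needs finiteness, since infinite cardinals
    absorb smaller summands. *)
Lemma card_le_cancel (T : Type) (A A' C : set T) :
  finite_set A' -> A `\` C = A' `\` C -> A #<= A' -> A `&` C #<= A' `&` C.
Proof.
move=> finA' eqD leA; have finA := card_le_finite leA finA'.
have [a Ia] := finite_setIl C finA; have [a' Ia'] := finite_setIl C finA'.
have [b Db] := finite_setD C finA.
have D'b : A' `\` C #= `I_b by rewrite -eqD.
have disj (B : set T) : (B `&` C) `&` (B `\` C) = set0.
  by rewrite -subset0 => x [[_ Cx] [_]].
have := card_eq_disjU Ia Db (disj A); have := card_eq_disjU Ia' D'b (disj A').
rewrite !setUIDK => cA' cA.
move: leA; rewrite (card_le_eql cA) (card_le_eqr cA') (card_le_eql Ia).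
by rewrite (card_le_eqr Ia') !card_le_II leq_add2r.
Qed.

Lemma block_index (V I : Type) (L : I -> set V) : partitions L ->
  exists k : V -> I, forall i x, L i x <-> k x = i.
Proof.
move=> [trivL coverL].
have [k kL] : {k : V -> I & forall x, L (k x) x}.
  apply: (@choice _ _ (fun x i => L i x)) => x.
  by have [i _ Lix] : (\bigcup_i L i) x by [rewrite coverL]; exists i.
exists k => i x; split=> [Lix|<-]; last exact: kL.
by apply: (trivL _ _ Logic.I Logic.I); exists x.
Qed.

(** A point determines its block, so injections between the traces that respect
    the blocks glue to an injection. *)
Lemma card_le_glue (T I : Type) (L : I -> set T) (A B : set T) :
  partitions L -> (forall i, A `&` L i #<= B `&` L i) -> A #<= B.
Proof.
elim/Ppointed: T => T in L A B *; first by rewrite emptyE.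
move=> /block_index[k kL] leAB.
have [g gP] : {g : I -> T -> T & forall i, set_inj (A `&` L i) (g i) /\
    forall x, (A `&` L i) x -> (B `&` L i) (g i x)}.
  apply: (@choice _ _ (fun i h => set_inj (A `&` L i) h /\
    forall x, (A `&` L i) x -> (B `&` L i) (h x))) => i.
  have /pcard_leP[f] := leAB i.
  by exists f; split=> [|x ALx]; [exact: inj | exact: (@funS _ _ _ _ f)].
have Lk x : L (k x) x by apply/kL.
have leh : (fun x => g (k x) x) @` A #<= B.
  apply: subset_card_le => _ [x Ax <-].
  by have [] := (gP (k x)).2 x (conj Ax (Lk x)).
apply: card_le_trans leh.
rewrite (card_le_eqr (inj_card_eq _))// => x y /set_mem Ax /set_mem Ay gxy.
have [_ /kL kgx] := (gP (k x)).2 x (conj Ax (Lk x)).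
have [_ /kL kgy] := (gP (k y)).2 y (conj Ay (Lk y)).
(* The values lie in the blocks of x and y, which therefore coincide. *)
have kxy : k x = k y by rewrite -kgx gxy kgy.
apply: (gP (k x)).1; last by rewrite gxy kxy.
- exact: mem_set.
- by apply: mem_set; rewrite kxy.
Qed.

(** * Comparing distances block by block *)

Lemma dist_le_glue (d : hamming_variant) (V I : Type) (L : I -> set V)
    (A B : set V) : partitions L ->
  (forall i, dist_le d (A `&` L i) (B `&` L i)) -> dist_le d A B.
Proof.
case: d => /= pL leAB; last exact: card_le_glue leAB.
move=> x Ax; have [i _ Lix] : (\bigcup_i L i) x by rewrite pL.2.
by have [] := leAB i x (conj Ax Lix).
Qed.

Lemma partitions_setC (V : Type) (C : set V) :
  partitions (fun b : bool => if b then C else ~` C).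
Proof.
split; first by move=> [] [] _ _ [x []].
rewrite -subTset => x _; have [Cx|nCx] := pselect (C x).
  by exists true.
by exists false.
Qed.

(** Finiteness is asked of the counting variant only, because a minimal distance
    of the set variant may be infinite. *)
Definition tame (d : hamming_variant) (T : Type) (A : set T) : Prop :=
  d = CountingVariant -> finite_set A.

(** Outside [C] nothing changes, so [A'] is at most [A] by gluing over [C] and its
    complement, and the reverse comparison would cancel to one on [C]. *)
Lemma dist_lt_splice (d : hamming_variant) (V : Type) (A A' C : set V) :
  tame d A -> A' `\` C = A `\` C ->
  dist_lt d (A' `&` C) (A `&` C) -> dist_lt d A' A.
Proof.
move=> tameA eqD [leI nleI].
have leA : dist_le d A' A.
  apply: dist_le_glue (partitions_setC C) _ => -[//|].
  by rewrite -!setDE eqD; case: (d) => //=; exact: card_lexx.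
split=> // leA'; apply: nleI; case: d => /= in tameA leI leA leA' *.
  exact: setSI.
apply: card_le_cancel => //; exact: card_le_finite leA (tameA erefl).
Qed.

(** Minimality of the trace on [C] turns into a comparison: for the set variant
    because the inclusion of [H'] in [H] restricts to the traces, for the counting
    variant because a finite cardinal is comparable with any other. *)
Lemma dist_le_of_nlt (d : hamming_variant) (T : Type) (H H' C : set T) :
  tame d (H `&` C) -> dist_le d H' H ->
  ~ dist_lt d (H' `&` C) (H `&` C) -> dist_le d (H `&` C) (H' `&` C).
Proof.
move=> tameH leH nlt; apply: contrapT => nle; apply: nlt; split=> //.
case: d => /= in tameH leH nle *; first exact: setSI.
by case: (finite_card_le_total (H' `&` C) (tameH erefl)).
Qed.

(** Every infinite cardinal is strictly larger than a finite one. *)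
Lemma minimal_dist_finite (d : hamming_variant) (T : Type) (A B : set T) :
  finite_set B -> ~ dist_lt d B A -> tame d A.
Proof.
move=> finB nlt dE; rewrite {}dE in nlt; apply: contrapT => infA; apply: nlt.
have nAB : ~ (A #<= B) by move=> /card_le_finite /(_ finB).
by split=> //=; case: (finite_card_le_total A finB).
Qed.

(** * Models on a block *)

Lemma sigLP (V : Type) (A : set V) (f g : model V) :
  sigL A f = sigL A g <-> forall x, A x -> f x = g x.
Proof.
rewrite -eq_sigLP; split=> fg x; last by move=> /set_mem; exact: fg.
by move=> Ax; apply: fg; exact: mem_set.
Qed.

Lemma hamming_sigL (V : Type) (A : set V) (s t : model V) :
  set_val @` hamming (sigL A s) (sigL A t) = hamming s t `&` A.
Proof.
apply/seteqP; split=> [_ [y sty <-]|x [stx Ax]].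
  by split; [exact: sty | exact: set_valP].
by exists (SigSub (mem_set Ax)).
Qed.

Lemma hamming_agree (V : Type) (A : set V) (s s' t t' : model V) :
  sigL A s = sigL A s' -> sigL A t = sigL A t' ->
  hamming s t `&` A = hamming s' t' `&` A.
Proof. by move=> ss' tt'; rewrite -!hamming_sigL ss' tt'. Qed.

Lemma dist_lt_sigL (d : hamming_variant) (V : Type) (A : set V)
    (s t s' t' : model V) :
  dist_lt d (hamming (sigL A s) (sigL A t)) (hamming (sigL A s') (sigL A t')) <->
  dist_lt d (hamming s t `&` A) (hamming s' t' `&` A).
Proof.
have leE (K K' : set A) :
    dist_le d K K' <-> dist_le d (set_val @` K) (set_val @` K').
  case: d => /=; last first.
    have val_eq (M : set A) : set_val @` M #= M.
      by apply: inj_card_eq => x y _ _; exact: val_inj.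
    by rewrite (card_le_eql (val_eq K)) (card_le_eqr (val_eq K')).
  split=> [KK'|KK' x Kx]; first exact: image_subset.
  by have [y K'y /val_inj <-] := KK' (set_val x) (ex_intro2 _ _ x Kx erefl).
by rewrite /dist_lt !leE !hamming_sigL.
Qed.

(** Minimality on a block, expressed by traces of distances between models of the
    whole language, so that different blocks can be compared in one type. *)
Lemma closest_restr (d : hamming_variant) (V : Type) (X Y : set (model V))
    (A : set V) (f : model V) :
  closest d (restr X A) (restr Y A) (sigL A f) <->
  exists s t, [/\ X s, Y t, sigL A t = sigL A f &
    forall s' t', X s' -> Y t' ->
      ~ dist_lt d (hamming s' t' `&` A) (hamming s t `&` A)].
Proof.
split=> [[[t Yt tf] [_ [s Xs <-] smin]]|[s [t [Xs Yt tf smin]]]].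
  exists s, t; split=> // s' t' Xs' Yt' /dist_lt_sigL; rewrite tf => lt.
  by apply: smin; exists (sigL A s'), (sigL A t'); split=> //;
    [exists s'|exists t'].
split; first by exists t.
exists (sigL A s); first by exists s.
move=> [_ [_ [[s' Xs' <-] [t' Yt' <-]]]]; rewrite -tf => /dist_lt_sigL.
exact: smin.
Qed.

(** * Sets of models that are products over a partition *)

(** The product property without restrictions: a model that agrees on each block
    with some member of [X] is itself in [X]. *)
Definition mixable (V I : Type) (L : I -> set V) (X : set (model V)) : Prop :=
  forall (m : I -> model V) (f : model V), (forall i, X (m i)) ->
    (forall i, sigL (L i) f = sigL (L i) (m i)) -> X f.

Lemma is_unionP (V I : Type) (L : I -> set V) (s : forall i, model (L i))
    (f : model V) : partitions L ->
  is_union s f <-> forall i, sigL (L i) f = s i.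
Proof.
move=> [_ coverL]; split=> [sf i|sf x b].
  by apply/funext => y; apply/sf; exists i, y.
split=> [<-|[i [y [<- <-]]]]; last by rewrite -sf.
have [i _ Lix] : (\bigcup_i L i) x by rewrite coverL.
by exists i, (SigSub (mem_set Lix)); rewrite -sf.
Qed.

Lemma model_prod_mixable (V I : Type) (L : I -> set V) (X : set (model V)) :
  partitions L -> X = model_prod (fun i => restr X (L i)) -> mixable L X.
Proof.
move=> pL XE m f Xm fm; rewrite XE.
exists (fun i => sigL (L i) f); last exact/is_unionP.
by move=> i; exists (m i).
Qed.

Lemma glue_models (V I : Type) (L : I -> set V) (m : I -> model V) :
  partitions L -> exists f : model V, forall i, sigL (L i) f = sigL (L i) (m i).
Proof.
move=> /block_index[k kL]; exists (fun x => m (k x) x) => i.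
by apply/sigLP => x /kL ->.
Qed.

Lemma mixable_patch (V I : Type) (L : I -> set V) (X : set (model V)) (i : I)
    (s s' : model V) :
  partitions L -> mixable L X -> X s -> X s' -> X (patch s (L i) s').
Proof.
move=> [trivL _] mixX Xs Xs'.
apply: (mixX (fun j => if pselect (j = i) then s' else s)) => j.
  by case: pselect.
apply/sigLP => x Ljx; rewrite /patch; case: pselect => /= [ji|ji].
  by rewrite mem_set// -ji.
rewrite memNset// => Lix; apply: ji.
by apply: (trivL _ _ Logic.I Logic.I); exists x.
Qed.

(** * The factorization *)

Section Factorization.
Variables (d : hamming_variant) (V I : Type) (L : I -> set V).
Variables (X Y : set (model V)).
Hypotheses (pL : partitions L) (mixX : mixable L X) (mixY : mixable L Y).
Hypothesis finXY : X !=set0 -> Y !=set0 ->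
  exists s t, [/\ X s, Y t & finite_set (hamming s t)].

(** An improvement [s', t'] on the block [L i] is spliced into the minimal pair
    [s, f]; the result is still in [X] and [Y] and is strictly closer. *)
Lemma closest_subset_prod : closest d X Y `<=`
  model_prod (fun i => closest d (restr X (L i)) (restr Y (L i))).
Proof.
move=> f [Yf [s Xs smin]].
have tameH : tame d (hamming s f).
  have [|s0 [t0 [Xs0 Yt0 fin0]]] := finXY (ex_intro _ s Xs); first by exists f.
  by apply: minimal_dist_finite fin0 _ => lt; apply: smin; exists s0, t0.
exists (fun i => sigL (L i) f); last exact/is_unionP.
move=> i; apply/closest_restr; exists s, f; split=> // s' t' Xs' Yt' ltH.
apply: smin; exists (patch s (L i) s'), (patch f (L i) t').
split; [exact: mixable_patch mixX _ _ | exact: mixable_patch mixY _ _ |].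
apply: (@dist_lt_splice _ _ _ _ (L i)) => //.
  by apply/seteqP; split=> x [+ nLx]; rewrite /hamming /patch /= memNset.
rewrite (@hamming_agree _ _ _ s' _ t')//; apply/sigLP => x Lx;
  by rewrite /patch mem_set.
Qed.

(** The partners of [f] on the blocks are glued to one partner [s] in [X], whose
    distance from [f] is then minimal on every block. *)
Lemma prod_subset_closest :
  model_prod (fun i => closest d (restr X (L i)) (restr Y (L i))) `<=`
  closest d X Y.
Proof.
move=> f [u umin /(is_unionP _ _ pL) fu].
have {}umin i : exists st : model V * model V,
    [/\ X st.1, Y st.2, sigL (L i) st.2 = sigL (L i) f &
      forall s' t', X s' -> Y t' -> ~ dist_lt d (hamming s' t' `&` L i)
                                             (hamming st.1 st.2 `&` L i)].
  have := umin i; rewrite -fu => /closest_restr[s [t ?]].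
  by exists (s, t).
have [m mP] := choice umin.
have Yf : Y f.
  by apply: (mixY (m := fun i => (m i).2)) => i; have [_ ? ? _] := mP i.
have [s sm] := glue_models (fun i => (m i).1) pL.
have Xs : X s by apply: mixX sm => i; have [] := mP i.
have HE i : hamming (m i).1 (m i).2 `&` L i = hamming s f `&` L i.
  by apply: hamming_agree; [rewrite sm | have [] := mP i].
have [|s0 [t0 [Xs0 Yt0 fin0]]] := finXY (ex_intro _ s Xs); first by exists f.
split=> //; exists s => // -[s' [t' [Xs' Yt' [leH]]]]; apply.
apply: dist_le_glue pL _ => i; have [_ _ _ mmin] := mP i.
rewrite HE in mmin; apply: dist_le_of_nlt => //; last exact: mmin.
by apply: minimal_dist_finite (mmin _ _ Xs0 Yt0); exact: finite_setIl.
Qed.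

End Factorization.

(** * Formulas mention finitely many variables *)

Fixpoint vars (V : Type) (phi : propform V) : set V :=
  match phi with
  | PVar p => [set p]
  | PBot => set0
  | PNot a => vars a
  | PAnd a b | POr a b | PImp a b => vars a `|` vars b
  end.

Lemma finite_vars (V : Type) (phi : propform V) : finite_set (vars phi).
Proof.
elim: phi => [p||a IHa|a IHa b IHb|a IHa b IHb|a IHa b IHb] //=;
  by [exact: finite_set1 | rewrite finite_setU].
Qed.

Lemma sat_agree (V : Type) (phi : propform V) (m m' : model V) :
  (forall x, vars phi x -> m x = m' x) -> sat m phi = sat m' phi.
Proof.
elim: phi => [p||a IHa|a IHa b IHb|a IHa b IHb|a IHa b IHb] //= mm'.
- exact: mm'.
- by rewrite IHa.
all: by rewrite IHa ?IHb// => x ?; apply: mm'; by [left | right].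
Qed.

(** The model that agrees with [t] on the variables of [phi] and with [s]
    elsewhere still satisfies [phi]. *)
Lemma finite_gap (V : Type) (phi : propform V) (s t : model V) :
  sat t phi -> exists2 t', sat t' phi & finite_set (hamming s t').
Proof.
move=> tphi; exists (patch s (vars phi) t).
  by rewrite -(sat_agree (m := t))// => x phix; rewrite /patch mem_set.
apply: sub_finite_set (finite_vars phi) => x stx.
by apply: contrapT => nphix; apply: stx; rewrite /patch memNset.
Qed.

Theorem fact3p2 (V : Type) (d : hamming_variant)
    (star : theory V -> propform V -> theory V) (hstar : defined_by d star)
    (T : theory V) (phi : propform V) (n : nat) (L : 'I_n -> set V)
    (hL : partitions L)
    (hT : theory_models T =
          model_prod (fun i => restr (theory_models T) (L i)))
    (hphi : form_models phi =
            model_prod (fun i => restr (form_models phi) (L i))) :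
  closest d (theory_models T) (form_models phi) =
  model_prod (fun i => closest d (restr (theory_models T) (L i))
                                 (restr (form_models phi) (L i))).
Proof.
have mixT := model_prod_mixable hL hT.
have mixphi := model_prod_mixable hL hphi.
have fin : theory_models T !=set0 -> form_models phi !=set0 ->
    exists s t, [/\ theory_models T s, form_models phi t &
                    finite_set (hamming s t)].
  move=> [s Ts] [t /(finite_gap s)[t' t'phi fin]].
  by exists s, t'.
apply/seteqP; split; first exact: closest_subset_prod.
exact: prod_subset_closest.
Qed.
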